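(* Let $N\ge2$, $R=\mathbb Z_N[x_1^{\pm1},x_2^{\pm1},x_3^{\pm1}]$, let $\mathbf f=(f_1,f_2,f_3)\in R^3$ be a regular sequence, and $S=R/(\mathbf f)$. For every $\mathbf a\in R^3$, the positive-degree superselection layers of $\mathcal C_{\mathbf a}(\mathbf f;\mathbb Z_N)$ are independent of $\mathbf a$ in both Pauli sectors and are given, as $R$-modules, by $$\operatorname{Ext}_R^\ell\bigl(\overline{\operatorname{coker}\varphi_{X,\mathbf a}},R\bigr)\cong_R\begin{cases} S, & \ell=1,2, \\ 0, & \ell\geq3, \end{cases}\qquad \operatorname{Ext}_R^\ell\bigl(\overline{\operatorname{coker}\varphi_{Z,\mathbf a}},R\bigr)\cong_R\begin{cases} \overline S, & \ell=1,2, \\ 0, & \ell\geq3. \end{cases}$$ Under these isomorphisms, translations (multiplication by monomials) act through the natural $R$-module structures of $S$ and $\overline S$, respectively.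
   Context: $R$ carries the $\mathbb Z_N$-linear involution $\overline{x^{\mathbf v}}=x^{-\mathbf v}$; for an $R$-module $M$, $\overline M$ is the same abelian group with action $r\ast m=\overline r\,m$; for matrices $\varphi^\dagger=\overline\varphi^{\mathsf T}$. A sequence $(f_1,f_2,f_3)$ is regular if $f_1$ is a non-zero-divisor in $R$ and each $f_i$ ($i=2,3$) is a non-zero-divisor on $R/(f_1,\dots,f_{i-1})$. Koszul modules and differentials: $K_0=R$, $K_1=R^3$ (basis $e_1,e_2,e_3$), $K_2=R^3$ (basis $e_{23},e_{31},e_{12}$), $K_3=R$ (basis $e_{123}$), $$\partial_1=\begin{pmatrix} f_1 & f_2 & f_3 \end{pmatrix},\quad \partial_2=\begin{pmatrix} 0 & f_3 & -f_2 \\ -f_3 & 0 & f_1 \\ f_2 & -f_1 & 0 \end{pmatrix},\quad \partial_3=\begin{pmatrix} f_1 \\ f_2 \\ f_3 \end{pmatrix}.$$ For a column vector $\mathbf a\in R^3$, the CSS code $\mathcal C_{\mathbf a}(\mathbf f;\mathbb Z_N)$ has stabilizer maps $$\varphi_{Z,\mathbf a}=\begin{pmatrix} \partial_2 & \mathbf a \\ 0 & \partial_3 \end{pmatrix}:K_2\oplus K_3\to K_1\oplus K_2,\qquad \varphi_{X,\mathbf a}=\begin{pmatrix} \partial_1^\dagger & 0 \\ -\overline{\mathbf a} & \partial_2^\dagger \end{pmatrix}:K_0^\dagger\oplus K_1^\dagger\to K_1^\dagger\oplus K_2^\dagger.$$ The $\ell$-th superselection layer of the $\sigma$-sector ($\sigma=X,Z$)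 is $\operatorname{Ext}_R^\ell(\overline{\operatorname{coker}\varphi_{\sigma,\mathbf a}},R)$. *)

(* Defs.v *)
(* MathComp, with mathcomp-classical so that submodules given by arbitrary
   propositions are boolean predicates. *)
From HB Require Import structures.
From mathcomp Require Import all_boot all_order all_algebra finmap.
From mathcomp.multinomials Require Import monalg.
From mathcomp Require Import boolp functions.

Set Implicit Arguments.
Unset Strict Implicit.
Unset Printing Implicit Defensive.

Import GRing.Theory.

Local Open Scope ring_scope.
Local Open Scope quotient_scope.

(** * Submodules, quotients, kernels, images *)

Record submodule (R : pzRingType) (V : lmodType R) := Submodule {
  smem :> {pred V};
  smemP : submod_closed smem }.

HB.instance Definition _ (R : pzRingType) (V : lmodType R) (S : submodule V) :=
  GRing.isSubmodClosed.Build R V (smem S) (smemP S).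

(* The submodule S, as a module in its own right. *)
Record submod (R : pzRingType) (V : lmodType R) (S : submodule V) := Submod {
  submod_val : V;
  submodP : smem S submod_val }.

Section SubmodInstances.
Variables (R : pzRingType) (V : lmodType R) (S : submodule V).
HB.instance Definition _ := [isSub for @submod_val R V S].
HB.instance Definition _ := [Choice of submod S by <:].
HB.instance Definition _ := [SubChoice_isSubLmodule of submod S by <:].
End SubmodInstances.

(* V / S, with canonical surjection [quo S]. *)
Definition quotmod (R : pzRingType) (V : lmodType R) (S : submodule V) : Type :=
  Quotient.quot (smem S).

HB.instance Definition _ (R : pzRingType) (V : lmodType R) (S : submodule V) :=
  GRing.Zmodule.copy (quotmod S) (Quotient.quot (smem S)).

Section Quotmod.
Variables (R : pzRingType) (V : lmodType R) (S : submodule V).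

Definition quo (x : V) : quotmod S := \pi_(Quotient.quot (smem S)) x.
Definition quo_repr (u : quotmod S) : V := repr (u : Quotient.quot (smem S)).

Lemma quo_reprK : cancel quo_repr quo.
Proof. by move=> u; rewrite /quo /quo_repr reprK. Qed.

Lemma eq_quo x y : (quo x = quo y) <-> (x - y \in smem S).
Proof.
by rewrite Quotient.idealrBE; split=> [/eqP|/eqP].
Qed.

Fact quo_is_zmod_morphism : zmod_morphism quo.
Proof. by move=> x y; rewrite /quo raddfB. Qed.

HB.instance Definition _ :=
  GRing.isZmodMorphism.Build V (quotmod S) quo quo_is_zmod_morphism.

Definition quo_scale (c : R) (u : quotmod S) : quotmod S := quo (c *: quo_repr u).

Lemma quo_scaleE c x : quo_scale c (quo x) = quo (c *: x).
Proof.
apply/eq_quo; rewrite -scalerBr rpredZ //.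
by apply/eq_quo; rewrite quo_reprK.
Qed.

Fact quo_scalerA a b u : quo_scale a (quo_scale b u) = quo_scale (a * b) u.
Proof. by rewrite -[u]quo_reprK !quo_scaleE scalerA. Qed.
Fact quo_scale1r : left_id 1 quo_scale.
Proof. by move=> u; rewrite -[u]quo_reprK quo_scaleE scale1r. Qed.
Fact quo_scalerDr : right_distributive quo_scale +%R.
Proof.
move=> a u v; rewrite -[u]quo_reprK -[v]quo_reprK -raddfD !quo_scaleE.
by rewrite scalerDr raddfD.
Qed.
Fact quo_scalerDl u : {morph quo_scale^~ u : a b / a + b}.
Proof.
by move=> a b; rewrite -[u]quo_reprK !quo_scaleE scalerDl raddfD.
Qed.

HB.instance Definition _ := GRing.Zmodule_isLmodule.Build R (quotmod S)
  quo_scalerA quo_scale1r quo_scalerDr quo_scalerDl.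

Fact quo_is_scalable : scalable quo.
Proof. by move=> a x; rewrite -quo_scaleE. Qed.

HB.instance Definition _ :=
  GRing.isScalable.Build R V (quotmod S) *:%R quo quo_is_scalable.

End Quotmod.

Section KerIm.
Variables (R : pzRingType) (U V : lmodType R) (f : {linear U -> V}).

Fact ker_closed : submod_closed [pred x | f x == 0].
Proof.
split=> [|a x y]; rewrite !inE ?raddf0 // linearP => /eqP-> /eqP->.
by rewrite scaler0 addr0.
Qed.
Definition ker : submodule U := Submodule ker_closed.

Fact im_closed : submod_closed [pred y | `[< exists x, f x = y >]].
Proof.
split=> [|a y z]; rewrite !inE; first by apply/asboolP; exists 0; rewrite raddf0.
move=> /asboolP[x <-] /asboolP[x' <-]; apply/asboolP.
by exists (a *: x + x'); rewrite linearP.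
Qed.
Definition im : submodule V := Submodule im_closed.

Fact preim_closed (S : submodule V) : submod_closed [pred x | f x \in smem S].
Proof.
split=> [|a x y]; rewrite !inE ?raddf0 ?rpred0 // linearP => Sx Sy.
by rewrite rpredD ?rpredZ.
Qed.
Definition preim (S : submodule V) : submodule U := Submodule (preim_closed S).

End KerIm.

Fact zero_closed (R : pzRingType) (V : lmodType R) :
  submod_closed [pred x : V | x == 0].
Proof.
by split=> [|a x y]; rewrite !inE // => /eqP-> /eqP->; rewrite scaler0 addr0.
Qed.
Definition zero_submodule (R : pzRingType) (V : lmodType R) : submodule V :=
  Submodule (@zero_closed R V).

(* Z / (Z ∩ B). *)
Definition subquot (R : pzRingType) (V : lmodType R) (Z B : submodule V) :=
  quotmod (preim (\val : submod Z -> V) B).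

(* The ideal generated by s, as a submodule of the regular module. *)
Section Ideal.
Variables (R : pzRingType) (s : seq R).

Fact ideal_closed : submod_closed
  [pred r : R^o | `[< exists c : 'I_(size s) -> R, r = \sum_i c i * s`_i >]].
Proof.
split=> [|a x y]; rewrite !inE.
  by apply/asboolP; exists (fun=> 0); rewrite big1 // => i _; rewrite mul0r.
move=> /asboolP[c ->] /asboolP[d ->]; apply/asboolP.
exists (fun i => a * c i + d i); rewrite /GRing.scale /= mulr_sumr -big_split /=.
by apply: eq_bigr => i _; rewrite mulrDl mulrA.
Qed.
Definition ideal : submodule R^o := Submodule ideal_closed.

End Ideal.

Definition nonzerodivisor (R : pzRingType) (M : lmodType R) (r : R) : Prop :=
  forall m : M, r *: m = 0 -> m = 0.

Definition regular_sequence3 (R : pzRingType) (f1 f2 f3 : R) : Prop :=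
  [/\ nonzerodivisor R^o f1,
      nonzerodivisor (quotmod (ideal [:: f1])) f2 &
      nonzerodivisor (quotmod (ideal [:: f1; f2])) f3].

(* The cokernel of the map R^n -> R^m of column vectors given by phi. *)
Definition coker (R : comNzRingType) m n (phi : 'M[R]_(m, n)) : lmodType R :=
  quotmod (im (mulmx phi : 'cV[R]_n -> 'cV[R]_m)).

(** * Ext *)

Section Hom.
Variables (R : comNzRingType) (U V : lmodType R).

Fact linear_fun_closed : submod_closed [pred h : U -> V | `[< linear h >]].
Proof.
split=> [|a g h]; rewrite !inE.
  by apply/asboolP => b x y; change (0 = b *: 0 + 0 :> V); rewrite scaler0 addr0.
move=> /asboolP gP /asboolP hP; apply/asboolP => b x y.
change (a *: g (b *: x + y) + h (b *: x + y) =
  b *: (a *: g x + h x) + (a *: g y + h y)).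
by rewrite gP hP !scalerDr !scalerA (mulrC a b) addrACA.
Qed.
Definition linear_fun : submodule (U -> V) := Submodule linear_fun_closed.

(* Hom_R(U, V), with the pointwise module structure. *)
Definition Hom : lmodType R := submod linear_fun.

End Hom.

Section Precomp.
Variables (R : comNzRingType) (U W V : lmodType R) (f : {linear U -> W}).

Fact precomp_subproof (h : Hom W V) : (\val h \o f) \in smem (linear_fun U V).
Proof.
apply/asboolP => a x y /=; rewrite linearP.
by have /asboolP -> := valP h.
Qed.
Definition precomp (h : Hom W V) : Hom U V := Submod (precomp_subproof h).

Fact precomp_is_linear : linear precomp.
Proof. by move=> a g h; apply: val_inj. Qed.
HB.instance Definition _ :=
  GRing.isLinear.Build R (Hom W V) (Hom U V) *:%R precomp precomp_is_linear.

End Precomp.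

(* The degree-n cohomology of Hom(F, Q), for a sequence of maps
   ... -> F 2 -> F 1 -> F 0. *)
Section HomCohomology.
Variables (R : comNzRingType) (F : nat -> lmodType R).
Variables (d : forall n, {linear F n.+1 -> F n}) (Q : lmodType R).

Definition cocycle (n : nat) : submodule (Hom (F n) Q) :=
  ker (precomp (V := Q) (d n)).

Definition coboundary (n : nat) : submodule (Hom (F n) Q) :=
  match n with
  | 0 => zero_submodule (Hom (F 0) Q)
  | k.+1 => im (precomp (V := Q) (d k))
  end.

Definition Hom_cohomology (n : nat) : lmodType R :=
  subquot (cocycle n) (coboundary n).

End HomCohomology.

(* The standard free resolution of M: F n is free on the elements of the n-th
   syzygy, where the 0-th syzygy is M and the (n+1)-st one is the kernel of the
   evaluation map from F n onto the n-th. *)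
HB.lock Definition free_eval (R : comNzRingType) (M : lmodType R)
  (g : {malg R[M]}) : M := \sum_(m <- msupp g) g@_m *: m.

Section StandardResolution.
Variable R : comNzRingType.

Lemma free_evalEw (M : lmodType R) (g : {malg R[M]}) (D : {fset M}) :
  (msupp g `<=` D)%fset -> free_eval g = \sum_(m <- D) g@_m *: m.
Proof.
move=> sgD; rewrite unlock (big_fset_incl _ sgD) // => m _ /mcoeff_outdom ->.
by rewrite scale0r.
Qed.

Fact free_eval_is_linear (M : lmodType R) : linear (@free_eval R M).
Proof.
move=> a g h; pose D := (msupp g `|` msupp h)%fset.
rewrite (@free_evalEw _ _ D) ?(@free_evalEw _ g D) ?(@free_evalEw _ h D);
  rewrite ?fsubsetUl ?fsubsetUr //.
  rewrite scaler_sumr -big_split /=; apply: eq_bigr => m _.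
  by rewrite mcoeffD mcoeffZ scalerDl scalerA.
by apply: fsubset_trans (msuppD_le _ _) _; apply/fsetSU/msuppZ_le.
Qed.
HB.instance Definition _ (M : lmodType R) :=
  GRing.isLinear.Build R {malg R[M]} M *:%R (@free_eval R M)
    (@free_eval_is_linear M).

Fixpoint syzygy (M : lmodType R) (n : nat) : lmodType R :=
  match n with
  | 0 => M
  | k.+1 => submod (ker (@free_eval R (syzygy M k)))
  end.

Definition std_free (M : lmodType R) (n : nat) : lmodType R :=
  {malg R[syzygy M n]}.

Definition std_diff (M : lmodType R) (n : nat) :
    {linear std_free M n.+1 -> std_free M n} :=
  (\val : submod (ker (@free_eval R (syzygy M n))) -> std_free M n)
    \o @free_eval R (syzygy M n.+1).

Lemma free_eval_surj (M : lmodType R) (m : M) : exists g, @free_eval R M g = m.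
Proof.
by exists << m >>; rewrite (free_evalEw msuppU_le) big_seq_fset1 mcoeffUU scale1r.
Qed.

Lemma std_augmentation_exact (M : lmodType R) (g : std_free M 0) :
  free_eval g = 0 <-> exists h, std_diff M 0 h = g.
Proof.
split=> [/eqP g0|[h <-]]; last exact/eqP/(valP (free_eval h)).
by have [h hP] := free_eval_surj (Submod (S := ker _) g0); exists h; rewrite /= hP.
Qed.

Lemma std_exact (M : lmodType R) (n : nat) (g : std_free M n.+1) :
  std_diff M n g = 0 <-> exists h, std_diff M n.+1 h = g.
Proof.
split=> [g0|[h <-]].
  have {}g0 : @free_eval R (syzygy M n.+1) g == 0 by apply/eqP/val_inj.
  by have [h hP] := free_eval_surj (Submod (S := ker _) g0); exists h; rewrite /= hP.
have h0 : free_eval (val (free_eval h)) = 0 by exact/eqP/(valP (free_eval h)).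
by apply: val_inj; rewrite /= h0.
Qed.

Definition Ext (n : nat) (M Q : lmodType R) : lmodType R :=
  Hom_cohomology (std_diff M) Q n.

End StandardResolution.

(** * Laurent polynomials *)

(* A[x_1^{±1}, ..., x_n^{±1}]: finitely supported functions from exponent
   vectors to A, with the convolution product. The group Z^n is not a monomType
   in the sense of monalg, whose ring structure therefore does not apply. *)
Definition laurent (A : comNzRingType) (n : nat) : Type := {malg A['rV[int]_n]}.

HB.instance Definition _ (A : comNzRingType) (n : nat) :=
  GRing.Zmodule.copy (laurent A n) {malg A['rV[int]_n]}.

HB.lock Definition lmul (A : comNzRingType) (n : nat) (g h : laurent A n) :
    laurent A n :=
  \sum_(u <- msupp g) \sum_(v <- msupp h) << g@_u * h@_v *g u + v >>.

(* The A-linear involution with x^v |-> x^(-v). *)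
HB.lock Definition bar (A : comNzRingType) (n : nat) (g : laurent A n) :
    laurent A n :=
  \sum_(v <- msupp g) << g@_v *g (- v) >>.

Section Laurent.
Variables (A : comNzRingType) (n : nat).
Local Notation L := (laurent A n).
Local Notation lmul := (@lmul A n).
Local Notation bar := (@bar A n).
Implicit Types (g h : L) (u v : 'rV[int]_n).

Lemma lmulEw (D E : {fset 'rV[int]_n}) g h :
    (msupp g `<=` D)%fset -> (msupp h `<=` E)%fset ->
  lmul g h = \sum_(u <- D) \sum_(v <- E) << g@_u * h@_v *g u + v >>.
Proof.
move=> sgD shE; rewrite unlock (big_fset_incl _ sgD) /=.
  apply: eq_bigr => u _; apply: big_fset_incl => // v _ /mcoeff_outdom ->.
  by rewrite mulr0 monalgU0.
move=> u _ /mcoeff_outdom gu; rewrite big1 // => v _.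
by rewrite gu mul0r monalgU0.
Qed.

Lemma lmulUU (a b : A) u v : lmul << a *g u >> << b *g v >> = << a * b *g u + v >>.
Proof. by rewrite (lmulEw msuppU_le msuppU_le) !big_seq_fset1 !mcoeffUU. Qed.

Fact lmulC : commutative lmul.
Proof.
move=> g h; rewrite unlock exchange_big /=; apply: eq_bigr => v _.
by apply: eq_bigr => u _; rewrite mulrC addrC.
Qed.

Fact lmulDl : left_distributive lmul +%R.
Proof.
move=> g g' h; pose D := (msupp g `|` msupp g')%fset.
rewrite (@lmulEw D (msupp h) g) ?(@lmulEw D (msupp h) g')
  ?(@lmulEw D (msupp h) (g + g')) ?fsubsetUl ?fsubsetUr ?msuppD_le //.
rewrite -big_split /=; apply: eq_bigr => u _.
rewrite -big_split /=; apply: eq_bigr => v _.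
by rewrite mcoeffD mulrDl monalgUD.
Qed.

Fact lmulDr : right_distributive lmul +%R.
Proof. by move=> h g g'; rewrite ![lmul h _]lmulC lmulDl. Qed.

Fact lmul0l : left_zero 0 lmul.
Proof. by move=> g; rewrite unlock msupp0 big_seq_fset0. Qed.

Fact lmul0r : right_zero 0 lmul.
Proof. by move=> g; rewrite lmulC lmul0l. Qed.

Lemma lmul_suml I (r : seq I) (F : I -> L) h :
  lmul (\sum_(i <- r) F i) h = \sum_(i <- r) lmul (F i) h.
Proof. exact: (big_morph (lmul^~ h) (fun g g' => lmulDl g g' h) (lmul0l h)). Qed.

Lemma lmul_sumr I (r : seq I) (F : I -> L) h :
  lmul h (\sum_(i <- r) F i) = \sum_(i <- r) lmul h (F i).
Proof. exact: (big_morph (lmul h) (lmulDr h) (lmul0r h)). Qed.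

Lemma monom_sum : exists2 mono : A -> 'rV[int]_n -> L,
    mono = (fun a v => << a *g v >>) &
    forall g, exists s : seq (A * 'rV[int]_n), g = \sum_(p <- s) mono p.1 p.2.
Proof.
exists (fun a v => << a *g v >>) => // g.
by exists [seq (g@_v, v) | v <- msupp g]; rewrite big_map; apply: monalgE.
Qed.

Fact lmulA : associative lmul.
Proof.
move=> g h k; have [mono monoE mono_sum] := monom_sum.
have monoM a b u v : lmul (mono a u) (mono b v) = mono (a * b) (u + v).
  by rewrite monoE lmulUU.
have [[[s ->] [t ->]] [r ->]] := (mono_sum g, mono_sum h, mono_sum k).
rewrite !lmul_suml; apply: eq_bigr => -[a u] _ /=.
rewrite [LHS]lmul_sumr [X in _ = lmul X _]lmul_sumr [RHS]lmul_suml.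
apply: eq_bigr => -[b v] _ /=; rewrite !lmul_sumr; apply: eq_bigr => -[c w] _ /=.
by rewrite !monoM mulrA addrA.
Qed.

Definition lone : L := << 1 *g 0 >>.

Fact lmul1l : left_id lone lmul.
Proof.
move=> g; rewrite [in RHS](monalgE g) (lmulEw msuppU_le (fsubset_refl _)).
rewrite big_seq_fset1; apply: eq_bigr => v _.
by rewrite mcoeffUU mul1r add0r.
Qed.

Fact lone_neq0 : lone != 0.
Proof. by rewrite monalgU_eq0 oner_eq0. Qed.

HB.instance Definition _ := GRing.Zmodule_isComNzRing.Build (laurent A n)
  lmulA lmulC lmul1l lmulDl lone_neq0.

(* The monomial x^v. *)
Definition xpow v : laurent A n := << 1 *g v >>.

Lemma barEw (D : {fset 'rV[int]_n}) g : (msupp g `<=` D)%fset ->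
  bar g = \sum_(v <- D) << g@_v *g (- v) >> :> L.
Proof.
move=> sgD; rewrite unlock (big_fset_incl _ sgD) // => v _ /mcoeff_outdom ->.
by rewrite monalgU0.
Qed.

Lemma barU (a : A) v : bar << a *g v >> = << a *g (- v) >>.
Proof. by rewrite (barEw msuppU_le) big_seq_fset1 mcoeffUU. Qed.

Fact bar_is_zmod_morphism : zmod_morphism bar.
Proof.
move=> g h; pose D := (msupp g `|` msupp h)%fset.
rewrite (@barEw D g) ?(@barEw D h) ?(@barEw D (g - h)) ?fsubsetUl ?fsubsetUr //;
  last exact: msuppB_le.
rewrite -sumrB; apply: eq_bigr => v _; by rewrite mcoeffB monalgUB.
Qed.
HB.instance Definition _ :=
  GRing.isZmodMorphism.Build (laurent A n) (laurent A n) bar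
    bar_is_zmod_morphism.

Fact bar_is_monoid_morphism : monoid_morphism bar.
Proof.
split=> [|g h]; first by rewrite barU oppr0.
have [mono monoE mono_sum] := monom_sum.
have barM a u b v : bar (mono a u * mono b v) = bar (mono a u) * bar (mono b v).
  have mulE (x y : L) : x * y = lmul x y by [].
  by rewrite !mulE monoE lmulUU !barU lmulUU opprD.
have [[s ->] [t ->]] := (mono_sum g, mono_sum h).
rewrite mulr_suml !raddf_sum mulr_suml; apply: eq_bigr => -[a u] _ /=.
rewrite !mulr_sumr raddf_sum; apply: eq_bigr => -[b v] _.
exact: barM.
Qed.
HB.instance Definition _ :=
  GRing.isMonoidMorphism.Build (laurent A n) (laurent A n) bar
    bar_is_monoid_morphism.

Lemma barK : involutive bar.
Proof.
move=> g; have [mono monoE mono_sum] := monom_sum; have [s ->] := mono_sum g.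
rewrite !raddf_sum; apply: eq_bigr => -[a u] _ /=.
by rewrite monoE !barU opprK.
Qed.

End Laurent.

(* The conjugate module: M with r acting as bar r. *)
Definition conjmod (A : comNzRingType) (n : nat) (M : lmodType (laurent A n)) :
  Type := M.

HB.instance Definition _ (A : comNzRingType) (n : nat)
    (M : lmodType (laurent A n)) := GRing.Zmodule.copy (conjmod M) M.

Section Conjmod.
Variables (A : comNzRingType) (n : nat) (M : lmodType (laurent A n)).

Definition conj_scale (r : laurent A n) (m : conjmod M) : conjmod M :=
  bar r *: (m : M).

Fact conj_scalerA a b m : conj_scale a (conj_scale b m) = conj_scale (a * b) m.
Proof. by rewrite /conj_scale scalerA rmorphM. Qed.
Fact conj_scale1r : left_id 1 conj_scale.
Proof. by move=> m; rewrite /conj_scale rmorph1 scale1r. Qed.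
Fact conj_scalerDr : right_distributive conj_scale +%R.
Proof. by move=> a x y; rewrite /conj_scale scalerDr. Qed.
Fact conj_scalerDl m : {morph conj_scale^~ m : a b / a + b}.
Proof. by move=> a b; rewrite /conj_scale rmorphD scalerDl. Qed.

HB.instance Definition _ := GRing.Zmodule_isLmodule.Build (laurent A n)
  (conjmod M) conj_scalerA conj_scale1r conj_scalerDr conj_scalerDl.

End Conjmod.

Definition dagger (A : comNzRingType) (d m n : nat) (phi : 'M[laurent A d]_(m, n)) :
  'M[laurent A d]_(n, m) := (map_mx (@bar A d) phi)^T.

(** * The codes *)

Section Codes.
Variables (N : nat).
Local Notation R := (laurent 'Z_N 3).
Variables (f1 f2 f3 : R) (a : 'cV[R]_3).

Definition rows_mx (m n : nat) (s : seq (seq R)) : 'M[R]_(m, n) :=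
  \matrix_(i, j) (nth [::] s i)`_j.

Definition partial1 : 'M[R]_(1, 3) := rows_mx 1 3 [:: [:: f1; f2; f3]].

(* Columns indexed by e_23, e_31, e_12. *)
Definition partial2 : 'M[R]_(3, 3) :=
  rows_mx 3 3 [:: [:: 0;    f3;   - f2];
                  [:: - f3; 0;    f1  ];
                  [:: f2;   - f1; 0   ]].

Definition partial3 : 'M[R]_(3, 1) := rows_mx 3 1 [:: [:: f1]; [:: f2]; [:: f3]].

Definition phiZ : 'M[R]_(3 + 3, 3 + 1) := block_mx partial2 a 0 partial3.

Definition phiX : 'M[R]_(3 + 3, 1 + 3) :=
  block_mx (dagger partial1) 0 (- map_mx (@bar 'Z_N 3) a) (dagger partial2).

End Codes.

(* The l-th superselection layer of the sector with stabilizer map phi. *)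
Definition superselection_layer (N m n : nat) (l : nat)
    (phi : 'M[laurent 'Z_N 3]_(m, n)) : lmodType (laurent 'Z_N 3) :=
  Ext l (conjmod (coker phi)) (laurent 'Z_N 3)^o.

(* S = R / (f1, f2, f3), and the class of r in S. *)
Definition koszul_quot (R : pzRingType) (f1 f2 f3 : R) : lmodType R :=
  quotmod (ideal [:: f1; f2; f3]).

Definition koszul_class (R : pzRingType) (f1 f2 f3 r : R) :
    koszul_quot f1 f2 f3 :=
  quo (ideal [:: f1; f2; f3]) r.

(* Main.v *)
(** Conjugation turns [coker phi] into the cokernel of the conjugated matrix. With
K2 and K3 the Koszul matrices of a regular sequence g, both sectors become cokernels
of B = [[K2, c], [0, K3]], with (g, c) = (f, -a) for X and (bar f, bar a) for Z. If
B (w, r) = 0 then K3 r = 0, so r = 0 and w lies in ker K2 = im K3; hence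
0 -> R -> R^4 -> R^6 is a free resolution whose last map (K3, 0) does not involve c.
Dualizing, degree 2 is R / (g). A 1-cocycle is a pair (w, r) with w K3 = 0, so
w = u K2, and it is cohomologous to (0, r - u c); the cocycle (0, s) is a coboundary
exactly when s is in (g), because u K2 = 0 makes u a multiple of the row g. Hence
degree 1 is R / (g) as well. Since Ext is defined through the standard free
resolution, this also needs the comparison of projective resolutions up to homotopy. *)

From HB Require Import structures.
From mathcomp Require Import all_boot all_order all_algebra finmap ring.
From mathcomp.multinomials Require Import monalg.
From mathcomp Require Import boolp.
Require Import Defs.

Set Implicit Arguments.
Unset Strict Implicit.
Unset Printing Implicit Defensive.

Import GRing.Theory.

Local Open Scope ring_scope.

(** * Linear maps and projective modules *)

Section LinearMaps.
Variable R : comNzRingType.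
Implicit Types U V W : lmodType R.

Definition pack_linear U V (f : U -> V) (fP : linear f) : {linear U -> V} :=
  HB.pack f (GRing.isLinear.Build R U V *:%R f fP).

(** Both targets are [U] modulo the same kernel. Sending [y] to [q] of a chosen preimage is well
    defined and linear since equality after [p] and equality after [q] coincide. *)
Lemma surjections_iso U V W (p : {linear U -> V}) (q : {linear U -> W}) :
    (forall y, exists x, p x = y) -> (forall y, exists x, q x = y) ->
    (forall x, p x = 0 <-> q x = 0) ->
  exists2 psi : {linear V -> W}, bijective psi & forall x, psi (p x) = q x.
Proof.
move=> p_surj q_surj pq0.
have pq x y : p x = p y <-> q x = q y.
  have [h1 h2] := pq0 (x - y); rewrite !linearB in h1 h2.
  by split=> e; apply/eqP; rewrite -subr_eq0; apply/eqP;
    [apply: h1 | apply: h2]; rewrite e subrr.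
pose s y := sval (cid (p_surj y)); pose t z := sval (cid (q_surj z)).
have sK y : p (s y) = y by rewrite /s; case: cid.
have tK z : q (t z) = z by rewrite /t; case: cid.
have psiP : linear (q \o s).
  by move=> a y z /=; rewrite -linearP; apply/pq; rewrite linearP !sK.
exists (pack_linear psiP) => [|x]; last by apply/pq; rewrite sK.
exists (p \o t) => [y|z] /=.
  by rewrite -[RHS]sK; apply/pq; rewrite tK.
by rewrite -[RHS]tK; apply/pq; rewrite sK.
Qed.

Section Restriction.
Variables (U V : lmodType R) (f : {linear U -> V}).
Variables (S : submodule U) (T : submodule V).
Hypothesis fST : forall x, x \in smem S -> f x \in smem T.

Definition restriction (x : submod S) : submod T := Submod (fST (submodP x)).

Fact restriction_is_linear : linear restriction.
Proof. by move=> a x y; apply: val_inj; rewrite /= linearP. Qed.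
HB.instance Definition _ := GRing.isLinear.Build R (submod S) (submod T) *:%R
  restriction restriction_is_linear.

End Restriction.

Lemma quo_surj V (S : submodule V) y : exists x, quo S x = y.
Proof. by exists (quo_repr y); rewrite quo_reprK. Qed.

Lemma quo_eq0 V (S : submodule V) x : quo S x = 0 <-> x \in smem S.
Proof. by rewrite -(raddf0 (quo S)) eq_quo subr0. Qed.

Lemma hom_linear U V (h : Hom U V) : linear (\val h).
Proof. exact/asboolP/(valP h). Qed.

Lemma hom_ext U V (h h' : Hom U V) : \val h =1 \val h' -> h = h'.
Proof. by move=> hh'; apply: val_inj; apply: funext. Qed.

Definition hom_of U V (f : {linear U -> V}) : Hom U V :=
  @Submod R _ (linear_fun U V) f (introT (asboolP _) (@linearP _ _ _ _ f)).

(** The lifting property asks only that the image of [g] lie in that of [p], so it applies directly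
    at an exact spot, with no corestriction to a submodule of cycles. *)
Definition projective (P : lmodType R) : Prop :=
  forall V W (p : {linear V -> W}) (g : {linear P -> W}),
    (forall x, exists y, p y = g x) ->
  exists k : {linear P -> V}, forall x, p (k x) = g x.

Lemma projective_free_module (M : choiceType) : projective {malg R[M]}.
Proof.
move=> V W p g pg; pose k m := sval (cid (pg << m >>)).
have kE m : p (k m) = g << m >> by rewrite /k; case: cid.
pose K (x : {malg R[M]}) := \sum_(m <- msupp x) x@_m *: k m.
(* Summing over any larger finite set allows [x], [y] and [a *: x + y] to be compared over a common
   support. *)
have KEw (x : {malg R[M]}) (D : {fset M}) : (msupp x `<=` D)%fset ->
    K x = \sum_(m <- D) x@_m *: k m.
  move=> sxD; rewrite /K (big_fset_incl _ sxD) // => m _ /mcoeff_outdom ->.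
  by rewrite scale0r.
have KP : linear K.
  move=> a x y; pose D := (msupp x `|` msupp y)%fset.
  rewrite (KEw _ D) ?(KEw x D) ?(KEw y D) ?fsubsetUl ?fsubsetUr //.
    rewrite scaler_sumr -big_split /=; apply: eq_bigr => m _.
    by rewrite mcoeffD mcoeffZ scalerDl scalerA.
  by apply: fsubset_trans (msuppD_le _ _) _; apply/fsetSU/msuppZ_le.
exists (pack_linear KP) => x /=.
rewrite [in RHS](monalgE x) !linear_sum; apply: eq_bigr => m _.
rewrite linearZ kE -linearZ /=; congr (g _).
by apply/malgP => n; rewrite mcoeffZ !mcoeffU mulrnAr mulr1.
Qed.

Lemma col_sum_delta n (x : 'cV[R]_n) : x = \sum_i x i 0 *: delta_mx i 0.
Proof. by rewrite [LHS]matrix_sum_delta; apply: eq_bigr => i _; rewrite big_ord1. Qed.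

Lemma projective_col n : projective 'cV[R]_n.
Proof.
move=> V W p g pg; pose k i := sval (cid (pg (delta_mx i 0))).
have kE i : p (k i) = g (delta_mx i 0) by rewrite /k; case: cid.
have KP : linear (fun x : 'cV[R]_n => \sum_i x i 0 *: k i).
  move=> a x y; rewrite scaler_sumr -big_split /=; apply: eq_bigr => i _.
  by rewrite !mxE scalerDl scalerA.
exists (pack_linear KP) => x /=.
rewrite [in RHS](col_sum_delta x) !linear_sum; apply: eq_bigr => i _.
by rewrite !linearZ /= kE.
Qed.

End LinearMaps.

(** * Comparison of projective resolutions *)

Section Resolutions.
Variables (R : comNzRingType) (M : lmodType R).

(** Each exactness field is an equivalence; its right-to-left half says that consecutive maps
    compose to zero. *)
Record resolution := Resolution {
  res_module :> nat -> lmodType R;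
  res_diff : forall n, {linear res_module n.+1 -> res_module n};
  res_aug : {linear res_module 0 -> M};
  res_projective : forall n, projective (res_module n);
  res_aug_surj : forall m, exists x, res_aug x = m;
  res_aug_exact : forall x, res_aug x = 0 <-> exists y, res_diff 0 y = x;
  res_exact : forall n x, res_diff n x = 0 <-> exists y, res_diff n.+1 y = x }.

(** The augmentation serves as the differential leaving degree 0, so that inductions treat all
    degrees alike. *)
Definition res_cycle (F : resolution) n : F n -> Prop :=
  match n with
  | 0 => fun x => res_aug F x = 0
  | k.+1 => fun x => res_diff F k x = 0
  end.

Lemma res_cycleP (F : resolution) n (x : F n) :
  res_cycle x <-> exists y, res_diff F n y = x.
Proof. by case: n x => [|n] x; [exact: res_aug_exact | exact: res_exact]. Qed.

Lemma res_diff_cycle (F : resolution) n (x : F n.+1) : res_cycle (res_diff F n x).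
Proof. by apply/res_cycleP; exists x. Qed.

Lemma res_diffK (F : resolution) n (x : F n.+2) :
  res_diff F n (res_diff F n.+1 x) = 0.
Proof. exact: (@res_diff_cycle F n.+1). Qed.

Definition chain_map (F G : resolution) (f : forall n, {linear F n -> G n}) :=
  forall n x, res_diff G n (f n.+1 x) = f n (res_diff F n x).

Lemma chain_lift (F G : resolution) :
  exists2 f : forall n, {linear F n -> G n},
    chain_map f & forall x, res_aug G (f 0%N x) = res_aug F x.
Proof.
have [f0 f0P] := @res_projective F 0 _ _ (res_aug G) (res_aug F)
  (fun x => res_aug_surj G (res_aug F x)).
(* Preserving cycles is the invariant that lets the next lift exist. *)
pose state n := {f : {linear F n -> G n} | forall x, res_cycle x -> res_cycle (f x)}.
have step n (f : state n) : exists f' : state n.+1,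
    forall x, res_diff G n (sval f' x) = sval f (res_diff F n x).
  case: f => f fP /=.
  have [x|f' f'P] := @res_projective F n.+1 _ _ (res_diff G n) (f \o res_diff F n).
    by apply/res_cycleP/fP/res_diff_cycle.
  suff cf x : res_cycle x -> res_cycle (f' x) by exists (exist _ f' cf).
  by rewrite /= f'P /= => ->; rewrite linear0.
have cf0 x : res_cycle x -> res_cycle (f0 x) by rewrite /= f0P.
(* Dependent choice: [cid] selects a next lift, and [nat_rect] iterates the selection. *)
pose f := nat_rect state (exist _ f0 cf0) (fun n fn => sval (cid (step n fn))).
exists (fun n => sval (f n)) => [n x|x]; last exact: f0P.
by rewrite /=; case: (cid (step n (f n))) => f' /= ->.
Qed.

(** The homotopy is built upwards: its next component lifts [k - h d] through the differential of
    [G], which is possible once that difference is a cycle. *)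
Lemma null_homotopic (F G : resolution) (k : forall n, {linear F n -> G n}) :
    chain_map k -> (forall x, res_aug G (k 0%N x) = 0) ->
  exists2 h : forall n, {linear F n -> G n.+1},
    forall x, k 0%N x = res_diff G 0 (h 0%N x) &
    forall n x, k n.+1 x = res_diff G n.+1 (h n.+1 x) + h n (res_diff F n x).
Proof.
move=> kd k0.
have [|h0 h0P] := @res_projective F 0 _ _ (res_diff G 0) (k 0%N).
  by move=> x; apply/res_aug_exact.
(* The invariant says exactly that [k n.+1 - h d] is killed by [res_diff G n]. *)
pose state n := {h : {linear F n -> G n.+1} |
  forall x, res_diff G n (h (res_diff F n x)) = res_diff G n (k n.+1 x)}.
have step n (h : state n) : exists h' : state n.+1, forall x,
    k n.+1 x = res_diff G n.+1 (sval h' x) + sval h (res_diff F n x).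
  case: h => h hP /=.
  have [|h' h'P] := @res_projective F n.+1 _ _ (res_diff G n.+1)
    (k n.+1 \- (h \o res_diff F n)).
    by move=> x; apply/res_exact; rewrite /= linearB hP subrr.
  have {}h'P x : res_diff G n.+1 (h' x) = k n.+1 x - h (res_diff F n x) by rewrite h'P.
  suff ch x : res_diff G n.+1 (h' (res_diff F n.+1 x)) = res_diff G n.+1 (k n.+2 x).
    by exists (exist _ h' ch) => x /=; rewrite h'P subrK.
  by rewrite h'P res_diffK linear0 subr0 kd.
have ch0 x : res_diff G 0 (h0 (res_diff F 0 x)) = res_diff G 0 (k 1%N x).
  by rewrite h0P kd.
pose h := nat_rect state (exist _ h0 ch0) (fun n hn => sval (cid (step n hn))).
exists (fun n => sval (h n)) => [x|n x] /=; first by rewrite h0P.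
by case: (cid (step n (h n))) => h'.
Qed.

(** * Independence of the cohomology of Hom from the resolution *)

Section Cohomology.
Variable Q : lmodType R.

Lemma cocycleE (F : resolution) n (phi : Hom (F n) Q) :
  phi \in smem (cocycle (res_diff F) Q n) <-> forall x, \val phi (res_diff F n x) = 0.
Proof.
rewrite inE; split=> [/eqP phi0 x|phi0].
  exact: (congr1 (fun h : Hom (F n.+1) Q => \val h x) phi0).
by apply/eqP/hom_ext => x; rewrite /= phi0.
Qed.

Lemma precomp_cocycle (F G : resolution) (f : forall n, {linear F n -> G n}) n
    (fd : chain_map f) (phi : Hom (G n) Q) :
  phi \in smem (cocycle (res_diff G) Q n) ->
  precomp (f n) phi \in smem (cocycle (res_diff F) Q n).
Proof. by move=> /cocycleE phi0; apply/cocycleE => x; rewrite /= -fd phi0. Qed.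

Lemma precomp_coboundary (F G : resolution) (f : forall n, {linear F n -> G n}) n
    (fd : chain_map f) (phi : Hom (G n) Q) :
  phi \in smem (coboundary (res_diff G) Q n) ->
  precomp (f n) phi \in smem (coboundary (res_diff F) Q n).
Proof.
case: n phi => [|n] phi; first by rewrite !inE => /eqP->; rewrite linear0.
rewrite !inE => /asboolP[psi <-]; apply/asboolP; exists (precomp (f n) psi).
by apply: hom_ext => x; rewrite /= fd.
Qed.

(** The map [k - id] lifts zero, hence equals [d h + h d]. A cocycle [phi] kills the first term, and
    the second yields the coboundary of [phi h]. *)
Lemma precomp_homotopic (F : resolution) (k : forall n, {linear F n -> F n}) n
    (phi : Hom (F n) Q) :
    chain_map k -> (forall x, res_aug F (k 0%N x) = res_aug F x) ->
    phi \in smem (cocycle (res_diff F) Q n) ->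
  precomp (k n) phi - phi \in smem (coboundary (res_diff F) Q n).
Proof.
move=> kd k0 /cocycleE phi0.
have subD j x : (k j \- idfun) x = k j x - x by [].
have [| |h h0 hS] := @null_homotopic F F (fun j => k j \- idfun).
- by move=> j x; rewrite /= !linearB kd.
- by move=> x; rewrite /= linearB k0 subrr.
have phiB x y : \val phi (x - y) = \val phi x - \val phi y.
  by rewrite -scaleN1r addrC (hom_linear phi) scaleN1r addrC.
have phiD x y : \val phi (x + y) = \val phi x + \val phi y.
  by rewrite -[x]scale1r (hom_linear phi) !scale1r.
have subE x : \val (precomp (k n) phi - phi) x = \val phi (k n x - x).
  by rewrite phiB.
(* In degree 0 only zero is a coboundary, but the homotopy formula has no [h d] term there
   either. *)
case: n phi phi0 phiB phiD subE => [|n] phi phi0 phiB phiD subE.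
  by rewrite inE; apply/eqP/hom_ext => x; rewrite subE -subD h0 phi0.
rewrite inE; apply/asboolP; exists (precomp (h n) phi).
by apply: hom_ext => x; rewrite subE -subD hS phiD phi0 add0r.
Qed.

(** Pulling back along [g] sends cocycles of [F] to cocycles of [G]. Surjectivity on classes follows
    from [f g] being homotopic to the identity, and the kernel is computed from [g f] being so. *)
Theorem cohomology_resolution_indep (F G : resolution) n :
  exists psi : {linear Hom_cohomology (res_diff F) Q n ->
                       Hom_cohomology (res_diff G) Q n}, bijective psi.
Proof.
have [f fd f0] := chain_lift F G; have [g gd g0] := chain_lift G F.
have gf_d : chain_map (fun j => g j \o f j) by move=> j x; rewrite /= gd fd.
have fg_d : chain_map (fun j => f j \o g j) by move=> j x; rewrite /= fd gd.
have gf0 x : res_aug F ((g 0%N \o f 0%N) x) = res_aug F x by rewrite /= g0 f0.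
have fg0 x : res_aug G ((f 0%N \o g 0%N) x) = res_aug G x by rewrite /= f0 g0.
pose pull := restriction (@precomp_cocycle _ _ _ n gd).
pose B H := preim (\val : submod (cocycle (res_diff H) Q n) -> _)
              (coboundary (res_diff H) Q n).
have [|||psi psi_bij _] := @surjections_iso R _ _ _ (quo (B F)) (quo (B G) \o pull).
- exact: quo_surj.
- move=> y; have [phi <-] := quo_surj y.
  exists (restriction (@precomp_cocycle _ _ _ n fd) phi).
  apply/eq_quo; have := precomp_homotopic fg_d fg0 (submodP phi).
  rewrite (_ : precomp _ (\val phi) = precomp (g n) (precomp (f n) (\val phi))) //.
  exact: hom_ext.
- move=> phi; rewrite /= !quo_eq0; split=> phiB.
    exact: (precomp_coboundary gd phiB).
  have := precomp_homotopic gf_d gf0 (submodP phi).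
  have -> : precomp (g n \o f n) (\val phi) = precomp (f n) (precomp (g n) (\val phi)).
    exact: hom_ext.
  move=> /(rpredB (precomp_coboundary fd phiB)).
  by rewrite opprB addrCA subrr addr0.
by exists psi.
Qed.

End Cohomology.

Definition std_resolution : resolution :=
  @Resolution (std_free M) (std_diff M) (@free_eval R M)
    (fun n => @projective_free_module R (syzygy M n)) (@free_eval_surj R M)
    (@std_augmentation_exact R M) (@std_exact R M).

End Resolutions.
(** * Cohomology of the twisted Koszul complex *)

Section MatrixComplexes.
Variables (R : comNzRingType) (r : nat -> nat).
Variable D : forall n, 'M[R]_(r n, r n.+1).

Definition mx_module n : lmodType R := 'cV[R]_(r n).
Definition mx_diff n : {linear mx_module n.+1 -> mx_module n} := mulmx (D n).

Fact row_functional_subproof m (y : 'rV[R]_m) :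
  linear (fun x : 'cV[R]_m => (y *m x) 0 0 : R^o).
Proof. by move=> a u v; rewrite linearP !mxE. Qed.
(** Writing the dual of a column module as rows turns precomposition with [D n] into right
    multiplication by [D n], without transposes. *)
Definition row_functional m (y : 'rV[R]_m) : Hom 'cV[R]_m R^o :=
  hom_of (pack_linear (row_functional_subproof y)).

Lemma row_functional_inj m : injective (@row_functional m).
Proof.
move=> y z /(congr1 (fun h : Hom _ _ => \val h)) /= yz; apply/rowP => j.
have := congr1 (fun h => h (delta_mx j 0)) yz => /=.
by rewrite -!colE !mxE.
Qed.

Lemma row_functional_surj m (h : Hom 'cV[R]_m R^o) : exists y, h = row_functional y.
Proof.
pose h' := pack_linear (hom_linear h).
exists (\row_j h' (delta_mx j 0)); apply: hom_ext => x /=.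
rewrite -[\val h x]/(h' x) [in LHS](col_sum_delta x) linear_sum mxE.
by apply: eq_bigr => j _; rewrite linearZ mxE mulrC.
Qed.

Fact row_functional_is_linear m : linear (@row_functional m).
Proof.
move=> a y z; apply: hom_ext => x.
rewrite -[RHS]/(a * (y *m x) 0 0 + (z *m x) 0 0) /=.
by rewrite mulmxDl -scalemxAl mxE [in LHS]mxE.
Qed.
HB.instance Definition _ m := GRing.isLinear.Build R 'rV[R]_m (Hom 'cV[R]_m R^o) *:%R
  (@row_functional m) (@row_functional_is_linear m).

Lemma precomp_row_functional n (y : 'rV[R]_(r n)) :
  precomp (mx_diff n) (row_functional y) = row_functional (y *m D n).
Proof. by apply: hom_ext => x /=; rewrite mulmxA. Qed.

Lemma row_functional_cocycle n (y : 'rV[R]_(r n)) :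
  row_functional y \in smem (cocycle mx_diff R^o n) <-> y *m D n = 0.
Proof.
have pyE := precomp_row_functional y; rewrite inE; split=> [/eqP py0|yD0].
  by apply: row_functional_inj; rewrite linear0 -pyE.
by apply/eqP; rewrite -[LHS]/(precomp (mx_diff n) (row_functional y)) pyE yD0
  linear0.
Qed.

Lemma row_functional_coboundary n (y : 'rV[R]_(r n.+1)) :
  row_functional y \in smem (coboundary mx_diff R^o n.+1) <-> exists z, y = z *m D n.
Proof.
rewrite inE; split=> [/asboolP[h hy]|[z ->]].
  have [z hz] := row_functional_surj h; exists z; apply: row_functional_inj.
  by rewrite -precomp_row_functional -hz -hy.
by apply/asboolP; exists (row_functional z); apply: precomp_row_functional.
Qed.

(** Here [p] parametrizes cocycles that represent every class, and [q] vanishes exactly where they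
    are coboundaries; [V] thus surjects onto the cohomology and onto [W] with the same kernel. *)
Lemma mx_cohomology n (V W : lmodType R)
    (p : {linear V -> 'rV[R]_(r n.+1)}) (q : {linear V -> W}) :
    (forall v, p v *m D n.+1 = 0) ->
    (forall y, y *m D n.+1 = 0 -> exists v z, y = p v + z *m D n) ->
    (forall w, exists v, q v = w) ->
    (forall v, q v = 0 <-> exists z, p v = z *m D n) ->
  exists psi : {linear Hom_cohomology mx_diff R^o n.+1 -> W}, bijective psi.
Proof.
move=> pD p_onto q_surj q0.
pose c v : submod (cocycle mx_diff R^o n.+1) :=
  Submod ((row_functional_cocycle (p v)).2 (pD v)).
have c_linear : linear c.
  by move=> a v w; apply: val_inj; rewrite /= linearP; apply: linearP.
pose B := preim (\val : submod (cocycle mx_diff R^o n.+1) -> _)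
            (coboundary mx_diff R^o n.+1).
have [|||psi psi_bij _] := @surjections_iso R _ _ _ (quo B \o pack_linear c_linear) q.
- move=> e; have [phi <-] := quo_surj e.
  have [y phiy] := row_functional_surj (\val phi).
  have /row_functional_cocycle/p_onto[v [z yE]] :
    row_functional y \in smem (cocycle mx_diff R^o n.+1) by rewrite -phiy; apply: submodP.
  exists v; apply/eq_quo.
  have -> : (c v - phi \in smem B) =
      (row_functional (p v) - \val phi \in smem (coboundary mx_diff R^o n.+1)) by [].
  have -> : row_functional (p v) - \val phi = row_functional (- z *m D n).
    rewrite phiy; apply: etrans (esym (linearB _ _ _)) _.
    by congr row_functional; rewrite yE opprD addNKr mulNmx.
  by apply/row_functional_coboundary; exists (- z).
- exact: q_surj.
- move=> v; rewrite q0 /= quo_eq0; exact: row_functional_coboundary.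
by exists psi.
Qed.

End MatrixComplexes.

(** * The length-two resolution attached to a twisted block matrix *)

Section TwistedComplex.
Variables (R : comNzRingType) (n : nat).
Variables (K2 : 'M[R]_n) (K3 c : 'cV[R]_n).
(** The first three hypotheses make the twisted complex exact; the two on rows describe cocycles and
    coboundaries of its dual. *)
Hypothesis K2K3 : K2 *m K3 = 0.
Hypothesis K3_inj : forall x : 'cV_1, K3 *m x = 0 -> x = 0.
Hypothesis K2_exact : forall v : 'cV_n, K2 *m v = 0 -> exists s : 'cV_1, v = K3 *m s.
Hypothesis K3_row_exact : forall w : 'rV_n, w *m K3 = 0 -> exists u, w = u *m K2.
Hypothesis K2_row_exact : forall u : 'rV_n, u *m K2 = 0 -> exists s, u = s *m K3^T.

(** A [resolution] has a module in every degree, so zero modules continue the complex from degree 3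
    on. *)
Definition twisted_rank (i : nat) : nat :=
  match i with 0 => n + n | 1 => n + 1 | 2 => 1 | _ => 0 end.

Definition twisted_mx i : 'M[R]_(twisted_rank i, twisted_rank i.+1) :=
  match i with
  | 0 => block_mx K2 c 0 K3
  | 1 => col_mx K3 0
  | _ => 0
  end.

Lemma twisted_exact i (x : 'cV[R]_(twisted_rank i.+1)) :
  twisted_mx i *m x = 0 <-> exists y, twisted_mx i.+1 *m y = x.
Proof.
case: i x => [|[|i]] /= x.
- rewrite -[x]vsubmxK mul_block_col mul0mx add0r.
  move: (usubmx x) (dsubmx x) => u d {x}; split=> [|[y]].
    (* The lower block forces [d = 0], which removes [c] from the upper one. *)
    rewrite -[RHS]col_mx0 => /eq_col_mx[e /K3_inj d0].
    move: e; rewrite d0 mulmx0 addr0 => /K2_exact[s ->].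
    by exists s; rewrite mul_col_mx mul0mx.
  rewrite mul_col_mx mul0mx => /eq_col_mx[<- <-].
  by rewrite mulmxA K2K3 mul0mx !mulmx0 addr0 col_mx0.
- split=> [|[y <-]]; last by rewrite mul0mx mulmx0.
  rewrite mul_col_mx -[RHS]col_mx0 => /eq_col_mx[/K3_inj-> _].
  by exists 0; rewrite mul0mx.
(* Here [x] lives in degree at least 3, so it has no entries. *)
split=> _; last by rewrite mul0mx.
by exists 0; rewrite mul0mx; apply/colP=> -[].
Qed.

Variables (M W : lmodType R) (eps : {linear 'cV[R]_(n + n) -> M}).
(** [W] is any presentation of the quotient of [R] by the ideal of the entries of [K3]; this covers
    a conjugate module as well as [R / (f1, f2, f3)]. *)
Variable q : {linear R^o -> W}.
Hypothesis eps_surj : forall m, exists x, eps x = m.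
Hypothesis eps_ker : forall x, eps x = 0 <-> exists y, block_mx K2 c 0 K3 *m y = x.
Hypothesis q_surj : forall w, exists s, q s = w.
Hypothesis q_ker : forall s, q s = 0 <-> exists x : 'rV_n, s%:M = x *m K3.

Definition twisted_resolution : resolution M :=
  @Resolution R M (mx_module R twisted_rank) (mx_diff twisted_mx) eps
    (fun i => @projective_col R (twisted_rank i)) eps_surj eps_ker twisted_exact.

Lemma twisted_cohomology1 :
  exists psi : {linear Hom_cohomology (mx_diff twisted_mx) R^o 1 -> W}, bijective psi.
Proof.
have p_linear : linear (fun s : R^o => row_mx 0 s%:M : 'rV[R]_(n + 1)).
  move=> a s t; rewrite scale_row_mx add_row_mx scaler0 addr0.
  by rewrite raddfD /= -scale_scalar_mx.
apply: (@mx_cohomology R _ twisted_mx 0 R^o W (pack_linear p_linear) q) => //=.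
- by move=> s; rewrite mul_row_col mul0mx mulmx0 addr0.
- move=> y; rewrite -[y]hsubmxK mul_row_col mulmx0 addr0 => /K3_row_exact[u ->].
  (* Subtracting the coboundary of [(u, 0)], which is [(u K2, u c)], clears the first block and
     leaves [r - u c] in the second. *)
  exists ((rsubmx y - u *m c) 0 0), (row_mx u 0).
  rewrite -mx11_scalar mul_row_block !mul0mx !addr0 add_row_mx add0r.
  by rewrite subrK.
move=> s; rewrite q_ker; split=> [[x sE]|[z]].
  exists (row_mx 0 x).
  by rewrite mul_row_block !mul0mx mulmx0 !add0r sE.
rewrite -[z]hsubmxK mul_row_block mulmx0 addr0 => /eq_row_mx[/esym/K2_row_exact[t uE] ->].
(* With [u = t K3^T], the term [u c] equals [t c^T K3], because the 1 by 1 matrix [K3^T c] is its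
   own transpose. *)
exists (t *m c^T + rsubmx z); rewrite mulmxDl uE; congr (_ + _).
rewrite -!mulmxA; congr (_ *m _).
by rewrite [LHS]mx11_scalar -tr_scalar_mx -mx11_scalar trmx_mul trmxK.
Qed.

Lemma twisted_cohomology2 :
  exists psi : {linear Hom_cohomology (mx_diff twisted_mx) R^o 2 -> W}, bijective psi.
Proof.
have p_linear : linear (fun s : R^o => s%:M : 'rV[R]_1).
  by move=> a s t; rewrite raddfD /= -scale_scalar_mx.
apply: (@mx_cohomology R _ twisted_mx 1 R^o W (pack_linear p_linear) q) => //=.
- by move=> s; rewrite mulmx0.
- by move=> y _; exists (y 0 0), 0; rewrite mul0mx addr0 -mx11_scalar.
move=> s; rewrite q_ker; split=> [[x sE]|[z]].
  by exists (row_mx x 0); rewrite mul_row_col mul0mx addr0.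
by rewrite -[z]hsubmxK mul_row_col mulmx0 addr0 => ->; exists (lsubmx z).
Qed.

Lemma twisted_cohomology_ge3 i (e : Hom_cohomology (mx_diff twisted_mx) R^o i.+3) : e = 0.
Proof.
have [phi <-] := quo_surj e.
suff -> : phi = 0 by rewrite linear0.
apply: val_inj; have [y ->] := row_functional_surj (\val phi).
by rewrite [y]thinmx0 linear0.
Qed.

Theorem twisted_Ext :
  (forall l, l = 1%N \/ l = 2%N ->
     exists psi : {linear Ext l M R^o -> W}, bijective psi) /\
  (forall l, (3 <= l)%N -> forall e : Ext l M R^o, e = 0).
Proof.
have indep l := cohomology_resolution_indep R^o (std_resolution M) twisted_resolution l.
split=> [l l12|l l3 e].
  have [psi psi_bij] := indep l.
  have [chi chi_bij] :
      exists chi : {linear Hom_cohomology (mx_diff twisted_mx) R^o l -> W}, bijective chi.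
    by case: l12 => ->; [exact: twisted_cohomology1 | exact: twisted_cohomology2].
  by exists (chi \o psi); apply: bij_comp.
case: l l3 e => [|[|[|l]]] // _ e.
have [psi psi_bij] := indep l.+3.
by apply: (bij_inj psi_bij); rewrite linear0; apply: twisted_cohomology_ge3.
Qed.

End TwistedComplex.

(** * Exactness of the Koszul complex *)

Section KoszulExactness.
Variable R : comNzRingType.
Implicit Types f x y z : R.

(** Vanishing in a quotient is spelled out by explicit multiples, so that the conditions can be
    carried through [bar] equation by equation. *)
Definition weakly_regular3 f1 f2 f3 : Prop :=
  [/\ forall x, f1 * x = 0 -> x = 0,
      forall x y, f2 * x = f1 * y -> exists z, x = f1 * z &
      forall x y1 y2, f3 * x = f1 * y1 + f2 * y2 ->
        exists z1 z2, x = f1 * z1 + f2 * z2].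

Lemma regular_sequence3_weakly f1 f2 f3 :
  regular_sequence3 f1 f2 f3 -> weakly_regular3 f1 f2 f3.
Proof.
case=> reg1 reg2 reg3; split=> [x|x y xy|x y1 y2 xy]; first exact: reg1.
  have /reg2/quo_eq0 : f2 *: quo (ideal [:: f1]) x = 0.
    rewrite -linearZ; apply/quo_eq0; rewrite inE; apply/asboolP.
    by exists (fun=> y); rewrite big_ord1 mulrC -xy.
  by rewrite inE => /asboolP[z ->]; exists (z 0); rewrite big_ord1 mulrC.
have /reg3/quo_eq0 : f3 *: quo (ideal [:: f1; f2]) x = 0.
  rewrite -linearZ; apply/quo_eq0; rewrite inE; apply/asboolP.
  exists (fun i => nth 0 [:: y1; y2] i).
  by rewrite !big_ord_recl big_ord0 addr0 mulrC [y2 * _]mulrC.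
rewrite inE => /asboolP[z ->].
by exists (z 0), (z (lift 0 0)); rewrite !big_ord_recl big_ord0 addr0 mulrC [f2 * _]mulrC.
Qed.

Variables f1 f2 f3 : R.
Hypothesis f_reg : weakly_regular3 f1 f2 f3.

(** Regularity of [f2] modulo [f1] gives [v1 = f1 s] from the third equation; cancelling [f1] then
    determines [v2] and [v3]. *)
Lemma koszul_exact2 v1 v2 v3 :
    f3 * v2 = f2 * v3 -> f3 * v1 = f1 * v3 -> f2 * v1 = f1 * v2 ->
  exists s, [/\ v1 = f1 * s, v2 = f2 * s & v3 = f3 * s].
Proof.
have [reg1 reg2 _] := f_reg => e1 e2 e3.
have [s v1E] := reg2 _ _ e3.
exists s; split=> //; apply/eqP; rewrite -subr_eq0; apply/eqP/reg1.
  by rewrite mulrBr -e3 v1E; ring.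
by rewrite mulrBr -e2 v1E; ring.
Qed.

(** Regularity of [f3] gives [w3 = f1 z1 + f2 z2]. Substituting leaves a relation between [f1] and
    [f2] alone, so [w2 + f3 z2 = f1 t], and [w1] follows by cancelling [f1]. *)
Lemma koszul_exact1 w1 w2 w3 : f1 * w1 + f2 * w2 + f3 * w3 = 0 ->
  exists u1 u2 u3, [/\ w1 = f3 * u2 - f2 * u3, w2 = f1 * u3 - f3 * u1 &
                       w3 = f2 * u1 - f1 * u2].
Proof.
have [reg1 reg2 reg3] := f_reg => e.
have [|z1 [z2 w3E]] := reg3 w3 (- w1) (- w2).
  by apply/eqP; rewrite -subr_eq0 -e; apply/eqP; ring.
have [|t tE] := reg2 (w2 + f3 * z2) (- (w1 + f3 * z1)).
  by apply/eqP; rewrite -subr_eq0 -e w3E; apply/eqP; ring.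
exists z2, (- z1), t; split.
- apply/eqP; rewrite -subr_eq0; apply/eqP/reg1.
  have -> : f1 * (w1 - (f3 * - z1 - f2 * t)) = f1 * w1 + f1 * f3 * z1 + f2 * (f1 * t) by ring.
  by rewrite -tE -e w3E; ring.
- by rewrite -tE; ring.
by rewrite w3E; ring.
Qed.

End KoszulExactness.

(** * Exactness of the Koszul matrices on columns and on rows *)

Section KoszulMatrices.
Variables (N : nat).
Local Notation R := (laurent 'Z_N 3).
Variables f1 f2 f3 : R.
Local Notation K2 := (partial2 f1 f2 f3).
Local Notation K3 := (partial3 f1 f2 f3).

(** This is the cross product of [v] with [(f1, f2, f3)]. *)
Lemma partial2_mulE (v : 'cV[R]_3) :
  K2 *m v = \col_i nth 0 [:: f3 * v 1 0 - f2 * v 2 0;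
                             f1 * v 2 0 - f3 * v 0 0;
                             f2 * v 0 0 - f1 * v 1 0] i.
Proof.
have [e1 e2] : lift 0 0 = 1 :> 'I_3 /\ lift 0 (lift 0 0) = 2 :> 'I_3.
  by split; apply: val_inj.
apply/colP => i; rewrite !mxE !big_ord_recl big_ord0 !mxE /= e1 e2.
by case: i => [[|[|[|]]]] //= _; ring.
Qed.

Lemma partial3_mulE (s : 'cV[R]_1) :
  K3 *m s = \col_i nth 0 [:: f1 * s 0 0; f2 * s 0 0; f3 * s 0 0] i.
Proof.
apply/colP => i; rewrite !mxE big_ord1 !mxE /=.
by case: i => [[|[|[|]]]].
Qed.

(** Skew symmetry expresses the self-duality of the Koszul complex; it converts between statements
    on columns and on rows. *)
Lemma tr_partial2 : K2^T = - K2.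
Proof.
apply/matrixP => i j; rewrite !mxE.
by case: i => [[|[|[|]]]] //= _; case: j => [[|[|[|]]]] //= _;
  rewrite ?oppr0 ?opprK.
Qed.

Lemma mul_row_partial3 (w : 'rV[R]_3) :
  w *m K3 = (f1 * w 0 0 + f2 * w 0 1 + f3 * w 0 2)%:M.
Proof.
have [e1 e2] : lift 0 0 = 1 :> 'I_3 /\ lift 0 (lift 0 0) = 2 :> 'I_3.
  by split; apply: val_inj.
rewrite [LHS]mx11_scalar; congr (_%:M).
by rewrite !mxE !big_ord_recl big_ord0 !mxE /= e1 e2; ring.
Qed.

Lemma partial2_partial3 : K2 *m K3 = 0.
Proof.
apply/colP => i; rewrite partial2_mulE !mxE /=.
by case: i => [[|[|[|]]]] //= _; ring.
Qed.

Hypothesis f_reg : weakly_regular3 f1 f2 f3.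

Lemma partial3_inj (x : 'cV[R]_1) : K3 *m x = 0 -> x = 0.
Proof.
have [reg1 _ _] := f_reg.
rewrite partial3_mulE => /colP/(_ 0); rewrite !mxE /= => /reg1 x0.
by rewrite [x]mx11_scalar x0 raddf0.
Qed.

Lemma partial2_exact (v : 'cV[R]_3) : K2 *m v = 0 -> exists s : 'cV_1, v = K3 *m s.
Proof.
rewrite partial2_mulE => /colP Kv.
have [||| s [e0 e1 e2]] := koszul_exact2 f_reg (v1 := v 0 0) (v2 := v 1 0) (v3 := v 2 0).
- by apply/eqP; rewrite -subr_eq0; have := Kv 0; rewrite !mxE /= => ->.
- by apply/esym/eqP; rewrite -subr_eq0; have := Kv 1; rewrite !mxE /= => ->.
- by apply/eqP; rewrite -subr_eq0; have := Kv 2; rewrite !mxE /= => ->.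
exists s%:M; rewrite partial3_mulE; apply/colP => -[[|[|[|]]]] //= i3; rewrite !mxE /=.
- by rewrite -e0; congr (v _ _); apply: val_inj.
- by rewrite -e1; congr (v _ _); apply: val_inj.
by rewrite -e2; congr (v _ _); apply: val_inj.
Qed.

Lemma partial2_row_exact (u : 'rV[R]_3) : u *m K2 = 0 -> exists s, u = s *m K3^T.
Proof.
move=> /(congr1 trmx); rewrite trmx_mul tr_partial2 mulNmx trmx0.
move=> /eqP; rewrite oppr_eq0 => /eqP /partial2_exact[s us].
by exists s^T; rewrite -trmx_mul -us trmxK.
Qed.

Lemma partial3_row_exact (w : 'rV[R]_3) : w *m K3 = 0 -> exists u, w = u *m K2.
Proof.
rewrite mul_row_partial3 => /(congr1 (fun A : 'M_1 => A 0 0)); rewrite !mxE mulr1n.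
move=> /(koszul_exact1 f_reg)[u1 [u2 [u3 [e1 e2 e3]]]].
pose u : 'cV_3 := \col_i nth 0 [:: u1; u2; u3] i.
(* The sign cancels the one from transposing the skew matrix. *)
exists (- u^T); apply: trmx_inj; rewrite trmx_mul tr_partial2 linearN /= trmxK.
rewrite mulNmx mulmxN opprK partial2_mulE.
apply/colP => -[[|[|[|]]]] //= i3; rewrite !mxE /=.
- by rewrite -e1; congr (w _ _); apply: val_inj.
- by rewrite -e2; congr (w _ _); apply: val_inj.
by rewrite -e3; congr (w _ _); apply: val_inj.
Qed.

Lemma mem_ideal_partial3 (s : R) :
  s \in smem (ideal [:: f1; f2; f3]) <-> exists x : 'rV_3, s%:M = x *m K3.
Proof.
have [e1 e2] : lift 0 0 = 1 :> 'I_3 /\ lift 0 (lift 0 0) = 2 :> 'I_3.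
  by split; apply: val_inj.
rewrite inE; split=> [/asboolP[b ->]|[x /(congr1 (fun A : 'M_1 => A 0 0))]].
  exists (\row_i b i); rewrite mul_row_partial3 !big_ord_recl big_ord0 !mxE /= e1 e2.
  by congr (_%:M); ring.
rewrite mul_row_partial3 !mxE !mulr1n => ->; apply/asboolP; exists (x 0).
by rewrite !big_ord_recl big_ord0 /= e1 e2; ring.
Qed.

End KoszulMatrices.

(** * Conjugation *)

Section Conjugation.
Variables (A : comNzRingType) (d : nat).
Local Notation R := (laurent A d).

Lemma bar_inj : injective (@bar A d).
Proof. exact: inv_inj (@barK A d). Qed.

Lemma bar_mxK m n (B : 'M[R]_(m, n)) : map_mx (@bar A d) (map_mx (@bar A d) B) = B.
Proof. by apply/matrixP => i j; rewrite !mxE barK. Qed.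

(** Since [bar] is an involutive ring automorphism, each relation can be conjugated, solved for the
    original sequence, and conjugated back. *)
Lemma bar_weakly_regular3 (f1 f2 f3 : R) :
  weakly_regular3 f1 f2 f3 -> weakly_regular3 (bar f1) (bar f2) (bar f3).
Proof.
case=> reg1 reg2 reg3; split=> [x e|x y e|x y1 y2 e].
- apply: bar_inj; rewrite rmorph0; apply: reg1.
  by apply: bar_inj; rewrite rmorphM /= barK e rmorph0.
- have [|z zE] := reg2 (bar x) (bar y).
    by apply: bar_inj; rewrite !rmorphM /= !barK.
  by exists (bar z); apply: bar_inj; rewrite zE rmorphM /= !barK.
have [|z1 [z2 zE]] := reg3 (bar x) (bar y1) (bar y2).
  by apply: bar_inj; rewrite rmorphD !rmorphM /= !barK.
by exists (bar z1), (bar z2); apply: bar_inj; rewrite zE rmorphD !rmorphM /= !barK.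
Qed.

(** Entrywise [bar] followed by the quotient map is linear because [r] acts on the conjugate module
    as [bar r]. *)
Lemma conj_coker_augmentation m n (phi : 'M[R]_(m, n)) :
  exists eps : {linear 'cV[R]_m -> conjmod (coker phi)},
    (forall y, exists x, eps x = y) /\
    (forall x, eps x = 0 <-> exists y, map_mx (@bar A d) phi *m y = x).
Proof.
pose S := im (mulmx phi : 'cV[R]_n -> 'cV[R]_m).
pose e (x : 'cV[R]_m) : conjmod (coker phi) := quo S (map_mx (@bar A d) x).
have e_linear : linear e.
  move=> b x y; rewrite /e map_mxD map_mxZ linearD; congr (_ + _).
  exact: (linearZ_LR (quo S)).
exists (pack_linear e_linear); split=> [y|x] /=.
  have [x xy] := quo_surj (y : quotmod S); exists (map_mx (@bar A d) x).
  by rewrite /e bar_mxK.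
apply: iff_trans (quo_eq0 S _) _; rewrite inE; split=> [/asboolP[y yx]|[y <-]].
  by exists (map_mx (@bar A d) y); rewrite -map_mxM /= yx bar_mxK.
by apply/asboolP; exists (map_mx (@bar A d) y); rewrite map_mxM bar_mxK.
Qed.

(** This presents the conjugate of [R / I] as a cyclic module, the quotient of [R] by the image of
    [I] under [bar]. *)
Lemma conj_quo_linear (I : submodule R^o) :
  linear (fun s : R^o => quo I (bar s) : conjmod (quotmod I)).
Proof.
move=> b x y; rewrite [bar _](_ : _ = bar b *: (bar x : R^o) + bar y); last first.
  by rewrite raddfD; congr (_ + _); apply: rmorphM.
exact: (linearP (quo I)).
Qed.

End Conjugation.

(** * Conjugated stabilizer matrices in twisted block form *)

Section ConjugateMatrices.
Variables (N : nat).
Local Notation R := (laurent 'Z_N 3).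
Local Notation barN := (@bar 'Z_N 3).
Implicit Types f : R.

Lemma bar_partial2 f1 f2 f3 :
  map_mx barN (partial2 f1 f2 f3) = partial2 (bar f1) (bar f2) (bar f3).
Proof.
apply/matrixP => i j; rewrite !mxE.
by case: i => [[|[|[|]]]] //= _; case: j => [[|[|[|]]]] //= _; rewrite ?rmorph0 ?rmorphN.
Qed.

Lemma bar_partial3 f1 f2 f3 :
  map_mx barN (partial3 f1 f2 f3) = partial3 (bar f1) (bar f2) (bar f3).
Proof.
apply/matrixP => i j; rewrite !mxE [j]ord1.
by case: i => [[|[|[|]]]].
Qed.

Lemma bar_phiZ f1 f2 f3 a :
  map_mx barN (phiZ f1 f2 f3 a) =
  block_mx (partial2 (bar f1) (bar f2) (bar f3)) (map_mx barN a)
    0 (partial3 (bar f1) (bar f2) (bar f3)).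
Proof. by rewrite map_block_mx bar_partial2 bar_partial3 map_mx0. Qed.

Lemma bar_phiX f1 f2 f3 a :
  map_mx barN (phiX f1 f2 f3 a) =
  block_mx (partial3 f1 f2 f3) 0 (- a) (- partial2 f1 f2 f3).
Proof.
have p1 : (partial1 f1 f2 f3)^T = partial3 f1 f2 f3.
  by apply/matrixP => i j; rewrite !mxE [j]ord1; case: i => [[|[|[|]]]].
rewrite map_block_mx map_mx0 map_mxN /dagger !map_trmx !bar_mxK.
by rewrite p1 tr_partial2.
Qed.

Lemma swap_blocks_linear : linear (fun x : 'cV[R]_(3 + 3) => col_mx (dsubmx x) (usubmx x)).
Proof. by move=> b x y; rewrite !linearP scale_col_mx add_col_mx. Qed.

(* As partial1^T = partial3 and partial2^T = - partial2, swapping the two row blocks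
   and the two column blocks of phiX gives, up to a sign on the partial2 column, the
   shape of phiZ with -a for a. *)
Lemma phiX_augmentation f1 f2 f3 a :
  exists eps : {linear 'cV[R]_(3 + 3) -> conjmod (coker (phiX f1 f2 f3 a))},
    (forall y, exists x, eps x = y) /\
    (forall x, eps x = 0 <->
      exists y, block_mx (partial2 f1 f2 f3) (- a) 0 (partial3 f1 f2 f3) *m y = x).
Proof.
have [eps [eps_surj eps_ker]] := conj_coker_augmentation (phiX f1 f2 f3 a).
exists (eps \o pack_linear swap_blocks_linear); split=> [y|x] /=.
  have [x <-] := eps_surj y; exists (col_mx (dsubmx x) (usubmx x)).
  by rewrite col_mxKu col_mxKd vsubmxK.
rewrite eps_ker bar_phiX; split=> [] [y].
  rewrite -{1}[y]vsubmxK mul_block_col mul0mx addr0 => /eq_col_mx[yd yu].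
  (* Negating this block absorbs the sign of [- partial2]. *)
  exists (col_mx (- dsubmx y) (usubmx y)).
  by rewrite mul_block_col mul0mx add0r yd mulmxN -mulNmx addrC yu vsubmxK.
rewrite -{1}[y]vsubmxK mul_block_col mul0mx add0r => <-.
exists (col_mx (dsubmx y) (- usubmx y)); rewrite mul_block_col mul0mx addr0.
by rewrite col_mxKu col_mxKd mulmxN !mulNmx opprK addrC.
Qed.

End ConjugateMatrices.

Theorem fact10 (N : nat) (hN : (2 <= N)%N) (f1 f2 f3 : laurent 'Z_N 3)
    (hf : regular_sequence3 f1 f2 f3) (a : 'cV[laurent 'Z_N 3]_3) :
  [/\ (forall l : nat, l = 1%N \/ l = 2%N ->
         exists psi : {linear superselection_layer l (phiX f1 f2 f3 a) ->
                              koszul_quot f1 f2 f3},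
           bijective psi /\
           (forall (v : 'rV[int]_3) (e : superselection_layer l (phiX f1 f2 f3 a))
                   (r : laurent 'Z_N 3),
              psi e = koszul_class f1 f2 f3 r ->
              psi (xpow 'Z_N v *: e) = koszul_class f1 f2 f3 (xpow 'Z_N v * r))),
      (forall l : nat, (3 <= l)%N ->
         forall e : superselection_layer l (phiX f1 f2 f3 a), e = 0),
      (forall l : nat, l = 1%N \/ l = 2%N ->
         exists psi : {linear superselection_layer l (phiZ f1 f2 f3 a) ->
                              conjmod (koszul_quot f1 f2 f3)},
           bijective psi /\
           (forall (v : 'rV[int]_3) (e : superselection_layer l (phiZ f1 f2 f3 a))
                   (r : laurent 'Z_N 3),
              psi e = koszul_class f1 f2 f3 r ->
              psi (xpow 'Z_N v *: e) = koszul_class f1 f2 f3 (xpow 'Z_N (- v) * r))) &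
      (forall l : nat, (3 <= l)%N ->
         forall e : superselection_layer l (phiZ f1 f2 f3 a), e = 0)].
Proof.
have reg := regular_sequence3_weakly hf; have reg' := bar_weakly_regular3 reg.
pose I := ideal [:: f1; f2; f3].
have [epsX [epsX_surj epsX_ker]] := phiX_augmentation f1 f2 f3 a.
have [epsZ [epsZ_surj epsZ_ker]] := conj_coker_augmentation (phiZ f1 f2 f3 a).
have qX_ker (s : laurent 'Z_N 3) : quo I s = 0 <->
    exists x : 'rV_3, s%:M = x *m partial3 f1 f2 f3.
  by rewrite quo_eq0; apply: mem_ideal_partial3.
have qZ_linear := conj_quo_linear I.
have qZ_surj (y : conjmod (koszul_quot f1 f2 f3)) :
    exists s, pack_linear qZ_linear s = y.
  have [s sy] := quo_surj (y : quotmod I); exists (bar s).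
  by rewrite /= barK.
have qZ_ker (s : laurent 'Z_N 3) : pack_linear qZ_linear s = 0 <->
    exists x : 'rV_3, s%:M = x *m partial3 (bar f1) (bar f2) (bar f3).
  apply: iff_trans (quo_eq0 I _) _; rewrite mem_ideal_partial3 -bar_partial3.
  split=> [] [x sx]; exists (map_mx (@bar 'Z_N 3) x).
    by rewrite -map_mxM -sx map_scalar_mx /= barK.
  rewrite -[partial3 _ _ _]bar_mxK -map_mxM -sx.
  by rewrite map_scalar_mx.
(* The twist [c] is [- a] here, as read off from [epsX_ker]. *)
have [X12 X3] := twisted_Ext (partial2_partial3 f1 f2 f3) (partial3_inj reg)
  (partial2_exact reg) (partial3_row_exact reg) (partial2_row_exact reg)
  epsX_surj epsX_ker (@quo_surj _ _ I) qX_ker.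
have [|Z12 Z3] := twisted_Ext (c := map_mx (@bar 'Z_N 3) a)
  (partial2_partial3 (bar f1) (bar f2) (bar f3)) (partial3_inj reg')
  (partial2_exact reg') (partial3_row_exact reg') (partial2_row_exact reg')
  epsZ_surj _ qZ_surj qZ_ker.
  by rewrite -bar_phiZ.
split=> [l /X12[psi psi_bij]|l|l /Z12[psi psi_bij]|l]; [|exact: X3| |exact: Z3].
  by exists psi; split=> // v e r er; rewrite linearZ er /koszul_class -linearZ.
exists psi; split=> // v e r er; rewrite linearZ er.
(* On the conjugate module [x^v] acts through [bar], hence as multiplication by the monomial of
   exponent [- v]. *)
rewrite -[LHS]/(bar (xpow 'Z_N v) *: koszul_class f1 f2 f3 r) barU.
by rewrite /koszul_class -linearZ.
Qed.
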